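(* Let $H_1,H_2$ be two graphs such that $S(H_1,k)S(H_2,k')\ge S(H_2,k)S(H_1,k')$ for all positive integers $k>k'$, with strict inequality for at least one pair $(k,k')$. Then $\mathcal{A}(G\cup H_1)>\mathcal{A}(G\cup H_2)$ for every graph $G$.
   Context: All graphs are finite, simple and undirected. A coloring of a graph $G$ assigns colors to its vertices so that adjacent vertices receive different colors; two colorings are equivalent if they induce the same partition of the vertex set into color classes. $S(G,k)$ denotes the number of non-equivalent colorings of $G$ using exactly $k$ colors (so $S(G,k)=0$ if $k$ exceeds the order of $G$). Set $\mathcal{B}(G)=\sum_{k\ge1}S(G,k)$, $\mathcal{T}(G)=\sum_{k\ge1}kS(G,k)$ and $\mathcal{A}(G)=\mathcal{T}(G)/\mathcal{B}(G)$. $G\cup H$ denotes disjoint union. *)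

(* Defs.v *)
From mathcomp Require Import all_boot all_order all_algebra.

Set Implicit Arguments.
Unset Strict Implicit.
Unset Printing Implicit Defensive.

Import GRing.Theory.

Record graph := Graph {
  vertex :> finType;
  adj : rel vertex;
  adj_sym : symmetric adj;
  adj_irrefl : irreflexive adj
}.

Section Colorings.

Variable G : graph.

Definition proper_coloring (C : finType) (c : {ffun G -> C}) : bool :=
  [forall x, forall y, adj x y ==> (c x != c y)].

Definition color_classes (C : finType) (c : {ffun G -> C}) : {set {set G}} :=
  preim_partition c [set: G].

(* Equivalent colorings are those with the same image under [color_classes],
   so non-equivalent colorings are counted by counting these images. The k
   colors being all used, the palette may be taken to be 'I_k. *)
Definition num_colorings (k : nat) : nat :=
  #|[set color_classes c | c : {ffun G -> 'I_k}
                         & proper_coloring c && (c @: [set: G] == setT)]|.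

Lemma num_colorings_gt_order k : #|G| < k -> num_colorings k = 0.
Proof.
move=> ltGk; apply/eqP; rewrite cards_eq0; apply/eqP/setP=> P.
rewrite in_set0; apply/imsetP=> -[c /[!inE] /andP[_ /eqP cT] _].
have := leq_imset_card c [set: G].
by rewrite cT !cardsT card_ord leqNgt ltGk.
Qed.

(* By [num_colorings_gt_order], stopping at the order of G loses no term of
   the sums over all k >= 1. *)
Definition total_colorings : nat := \sum_(1 <= k < #|G|.+1) num_colorings k.

Definition total_colors : nat := \sum_(1 <= k < #|G|.+1) k * num_colorings k.

(* If G has no vertex then this is 0 / 0 = 0. *)
Definition avg_colors : rat := (total_colors%:R / total_colorings%:R)%R.

End Colorings.

Section DisjointUnion.

Variables G H : graph.

Definition union_adj : rel (G + H)%type := fun u v =>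
  match u, v with
  | inl x, inl y => adj x y
  | inr x, inr y => adj x y
  | _, _ => false
  end.

Lemma union_adj_sym : symmetric union_adj.
Proof. by move=> [x|x] [y|y] //=; apply: adj_sym. Qed.

Lemma union_adj_irrefl : irreflexive union_adj.
Proof. by move=> [x|x] /=; apply: adj_irrefl. Qed.

Definition disjoint_union : graph := Graph union_adj_sym union_adj_irrefl.

End DisjointUnion.

(* Main.v *)
(* Put [S H j = num_colorings H j]. Writing [n ^_ k] for falling factorials, the
   number of proper colorings of [H] with palette [x] is [\sum_k S H k * x ^_ k];
   since it is multiplicative over disjoint unions and such expansions are unique,
   [S (G + H) n = \sum_j S H j * w_j n], where
   [(\sum_n S G n * x ^_ n) * x ^_ j = \sum_n w_j n * x ^_ n]. Here [w_j n] is
   [S (G + K_j) n], governed by [w_(j+1) n = w_j (n - 1) + (n - j) * w_j n]. Let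
   [b_j] and [t_j] be the moments of order 0 and 1 of [w_j]. The recurrence and
   Cauchy-Schwarz make [t_j / b_j] strictly increasing. Thus the average for
   [G + H_i] is [(\sum_j S H_i j * t_j) / (\sum_j S H_i j * b_j)], a weighted mean
   of the increasing sequence [t_j / b_j], and the hypothesis orders the weights
   of [H1] and [H2] by likelihood ratio; the cross difference of the two
   averages is a sum over pairs [l < k] of products of two nonnegative
   differences. *)

Require Import Defs.
From mathcomp Require Import all_boot all_order all_algebra.
From mathcomp Require Import zify ring.

Set Implicit Arguments.
Unset Strict Implicit.
Unset Printing Implicit Defensive.

Import Order.TTheory GRing.Theory Num.Theory.

(** * Color classes and the falling factorial expansion *)

Lemma eq_color_classes (G : graph) (C D : finType)
    (c : {ffun G -> C}) (d : {ffun G -> D}) :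
  (color_classes c == color_classes d) =
  [forall x, forall y, (c x == c y) == (d x == d y)].
Proof.
have mem_block (E : finType) (e : {ffun G -> E}) x y :
    (y \in pblock (color_classes e) x) = (e x == e y).
  apply: pblock_equivalence_partition; rewrite ?inE //.
  by split=> // /eqP->.
apply/eqP/'forall_'forall_eqP => [cd x y | cd].
  by rewrite -!mem_block cd.
by apply: eq_imset => x; apply/setP=> y; rewrite !inE cd.
Qed.

(** Such a coloring is [c0] followed by an injection of its [k] colors into the palette of size
    [x]. *)
Lemma card_colorings_with_classes (G : graph) (k x : nat)
    (c0 : {ffun G -> 'I_k}) :
  proper_coloring c0 -> c0 @: [set: G] = setT ->
  #|[set c : {ffun G -> 'I_x} | [&& proper_coloring c, #|c @: [set: G]| == k
       & color_classes c == color_classes c0]]| = x ^_ k.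
Proof.
move=> c0_proper c0_surj.
have c0P i : exists v, c0 v == i.
  have: i \in c0 @: [set: G] by rewrite c0_surj inE.
  by case/imsetP=> v _ ->; exists v.
pose rep i := xchoose (c0P i).
have repK i : c0 (rep i) = i by apply/eqP/(xchooseP (c0P i)).
pose relabel (s : {ffun 'I_k -> 'I_x}) : {ffun G -> 'I_x} := [ffun v => s (c0 v)].
have relabel_inj : injective relabel.
  move=> s t /ffunP st; apply/ffunP=> i.
  by have := st (rep i); rewrite !ffunE repK.
have <- : #|[set s : {ffun 'I_k -> 'I_x} | injectiveb s]| = x ^_ k.
  by rewrite card_inj_ffuns !card_ord.
rewrite -(card_imset _ relabel_inj).
apply: eq_card => c; rewrite inE; apply/and3P/imsetP => [[_ _] | [s]].
  rewrite eq_color_classes => /'forall_'forall_eqP cc0.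
  exists [ffun i => c (rep i)].
    rewrite inE; apply/injectiveP=> i j; rewrite !ffunE => /eqP.
    by rewrite cc0 !repK => /eqP.
  apply/ffunP=> v; rewrite !ffunE; apply/eqP.
  by rewrite eq_sym cc0 repK.
rewrite inE => /injectiveP s_inj ->.
have cc0 v w : (relabel s v == relabel s w) = (c0 v == c0 w).
  by rewrite !ffunE inj_eq.
split.
- by apply/'forall_'forall_implyP => v w vw; rewrite cc0;
    have /'forall_'forall_implyP/(_ v w vw) := c0_proper.
- have -> : relabel s @: [set: G] = s @: (c0 @: [set: G]).
    by rewrite -imset_comp; apply: eq_imset => v; rewrite /= ffunE.
  by rewrite c0_surj card_imset // cardsT card_ord.
- by rewrite eq_color_classes; apply/'forall_'forall_eqP.
Qed.

Lemma surjective_recoloring (G : graph) (C : finType) (c : {ffun G -> C}) :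
  exists d : {ffun G -> 'I_#|c @: [set: G]|},
    color_classes d = color_classes c /\ d @: [set: G] = setT.
Proof.
have cP v : c v \in c @: [set: G] by rewrite imset_f ?inE.
(* Renumbering the used colors through [enum_rank_in] needs one of them, hence a vertex. *)
case: (pickP G) => [v0 _ | G0]; last first.
  have c0 : #|c @: [set: G]| = 0.
    apply/eqP; rewrite cards_eq0; apply/eqP/setP=> i; rewrite inE.
    by apply/imsetP=> -[v]; have := G0 v.
  rewrite c0; exists [ffun v => False_rect _ (notF (esym (G0 v)))].
  split; last by apply/setP=> -[].
  by apply/eqP; rewrite eq_color_classes; apply/forallP=> v; have := G0 v.
exists [ffun v => enum_rank_in (cP v0) (c v)]; split.
  apply/eqP; rewrite eq_color_classes; apply/'forall_'forall_eqP => v w.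
  by rewrite !ffunE (inj_in_eq (@enum_rank_in_inj _ _ _ _ (cP v0) (cP v0))).
apply/setP=> i; rewrite !inE; apply/imsetP.
have /imsetP[v _ iv] := enum_valP i.
by exists v => //; rewrite ffunE -iv enum_valK_in.
Qed.

Lemma eq_classes_proper (G : graph) (C D : finType)
    (c : {ffun G -> C}) (d : {ffun G -> D}) :
  color_classes c = color_classes d -> proper_coloring c = proper_coloring d.
Proof.
move/eqP; rewrite eq_color_classes => /'forall_'forall_eqP cd.
by apply: eq_forallb => v; apply: eq_forallb => w; rewrite cd.
Qed.

Definition chromatic (G : graph) (x : nat) : nat :=
  #|[set c : {ffun G -> 'I_x} | proper_coloring c]|.

(** Sort the colorings by the number [k] of colors used, then by partition: each partition
    contributes [x ^_ k]. *)
Lemma chromatic_ffact (G : graph) (N x : nat) :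
  #|G| < N -> chromatic G x = \sum_(k < N) num_colorings G k * x ^_ k.
Proof.
move=> GN.
have imN (c : {ffun G -> 'I_x}) : #|c @: [set: G]| < N.
  by apply: leq_ltn_trans GN; rewrite -cardsT leq_imset_card.
rewrite /chromatic -sum1_card.
rewrite (partition_big (fun c : {ffun G -> 'I_x} => Ordinal (imN c)) xpredT) //=.
apply: eq_bigr => k _.
rewrite (partition_big (@color_classes G _)
  (mem [set color_classes c | c : {ffun G -> 'I_k}
       & proper_coloring c && (c @: [set: G] == setT)])) /=; last first.
  move=> c /andP[]; rewrite inE => c_proper /eqP ck.
  have [d [dc d_surj]] := surjective_recoloring c.
  move: d dc d_surj; have -> : #|c @: [set: G]| = k by rewrite -ck.
  move=> d dc d_surj; apply/imsetP; exists d => //.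
  by rewrite inE (eq_classes_proper dc) c_proper d_surj eqxx.
rewrite [RHS](_ : _ = \sum_(P in [set color_classes c | c : {ffun G -> 'I_k}
       & proper_coloring c && (c @: [set: G] == setT)]) x ^_ k); last first.
  by rewrite sum_nat_const.
apply: eq_bigr => P /imsetP[c0]; rewrite inE => /andP[c0_proper /eqP c0_surj] ->.
rewrite -(card_colorings_with_classes x c0_proper c0_surj) -sum1_card.
by apply: eq_bigl => c; rewrite !inE -val_eqE /= andbA.
Qed.

Lemma chromatic_disjoint_union (G H : graph) (x : nat) :
  chromatic (disjoint_union G H) x = chromatic G x * chromatic H x.
Proof.
rewrite /chromatic -cardsX.
pose glue (p : {ffun G -> 'I_x} * {ffun H -> 'I_x}) :
    {ffun disjoint_union G H -> 'I_x} :=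
  [ffun u : G + H => match u with inl v => p.1 v | inr v => p.2 v end].
have glue_inj : injective glue.
  move=> [a b] [a' b'] /ffunP e; congr (_, _); apply/ffunP=> v.
    by have := e (inl v); rewrite !ffunE.
  by have := e (inr v); rewrite !ffunE.
rewrite -(card_imset _ glue_inj); apply: eq_card => c.
rewrite inE; apply/idP/imsetP => [/'forall_'forall_implyP c_proper | [[a b]]].
  exists ([ffun v => c (inl v)], [ffun v => c (inr v)]); last first.
    by apply/ffunP=> -[v|v]; rewrite !ffunE.
  rewrite !inE /=; apply/andP; split; apply/'forall_'forall_implyP=> v w vw.
    by rewrite !ffunE; apply: (c_proper (inl v) (inl w)).
  by rewrite !ffunE; apply: (c_proper (inr v) (inr w)).
rewrite !inE /= => /andP[/'forall_'forall_implyP a_proper].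
move=> /'forall_'forall_implyP b_proper ->.
apply/'forall_'forall_implyP=> -[v|v] [w|w] //= vw; rewrite !ffunE.
  exact: a_proper.
exact: b_proper.
Qed.

(** Evaluation at [x = n] is triangular: terms of index above [n] vanish, and the one of index [n]
    has the nonzero factor [n!]. *)
Lemma ffact_coef_inj (N : nat) (a b : nat -> nat) :
  (forall x, \sum_(n < N) a n * x ^_ n = \sum_(n < N) b n * x ^_ n) ->
  forall n, n < N -> a n = b n.
Proof.
move=> ab; elim/ltn_ind => n IHn nN.
have trunc (f : nat -> nat) :
    \sum_(i < N) f i * n ^_ i = \sum_(i < n) f i * n ^_ i + f n * n`!.
  rewrite -(big_mkord xpredT (fun i => f i * n ^_ i)) (big_cat_nat (n := n.+1)) //=.
  rewrite [X in _ + X]big1_seq ?addn0 => [|i]; last first.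
    by rewrite mem_index_iota => /andP[_ /andP[ni _]]; rewrite ffact_small ?muln0.
  by rewrite big_mkord big_ord_recr /= ffactnn.
have := ab n; rewrite !trunc.
rewrite (eq_bigr (fun i : 'I_n => b i * n ^_ i)) => [|i _]; last first.
  by rewrite IHn // (ltn_trans _ nN).
by move/addnI/eqP; rewrite eqn_pmul2r ?fact_gt0 // => /eqP.
Qed.

(** * Adding a clique *)

(* If [a n] counts the colorings of [G] with [n] colors, then [clique_union a j]
   counts those of [G] plus a disjoint clique on [j] vertices: one more clique
   vertex is alone in its class or joins one of the [n - j] classes that the
   clique does not meet. *)
Fixpoint clique_union (a : nat -> nat) (j n : nat) : nat :=
  if j is j'.+1 then
    (if n is n'.+1 then clique_union a j' n' else 0)
      + (n - j') * clique_union a j' n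
  else a n.

Lemma clique_union_small (a : nat -> nat) (j n : nat) :
  n < j -> clique_union a j n = 0.
Proof.
elim: j n => [|j IHj] // [|n] nj /=; first by rewrite sub0n mul0n.
by rewrite IHj // (_ : n.+1 - j = 0) //; lia.
Qed.

Lemma clique_union_large (a : nat -> nat) (m j n : nat) :
  (forall i, m <= i -> a i = 0) -> m + j <= n -> clique_union a j n = 0.
Proof.
move=> a0; elim: j n => [|j IHj] n mn /=; first by apply: a0; lia.
by case: n mn => [|n] mn; rewrite !IHj ?muln0 //; lia.
Qed.

(** Summation by parts moves the recurrence onto the test function [g]; the support bound kills the
    boundary term. *)
Lemma sum_clique_unionS (a : nat -> nat) (m N j : nat) (g : nat -> nat) :
  (forall i, m <= i -> a i = 0) -> m + j.+1 <= N ->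
  \sum_(n < N) clique_union a j.+1 n * g n =
  \sum_(n < N) clique_union a j n * (g n.+1 + (n - j) * g n).
Proof.
move=> a0; case: N => [|N] mN; first by rewrite !big_ord0.
under eq_bigr do rewrite /= mulnDl.
under [RHS]eq_bigr do rewrite mulnDr.
rewrite !big_split /=; congr (_ + _); last first.
  by apply: eq_bigr => n _; rewrite mulnCA mulnA.
rewrite big_ord_recl mul0n add0n big_ord_recr /=.
by rewrite (clique_union_large a0) ?addn0 //; lia.
Qed.

Lemma sum_clique_union_ffact (a : nat -> nat) (m N j x : nat) :
  (forall i, m <= i -> a i = 0) -> m + j <= N ->
  \sum_(n < N) clique_union a j n * x ^_ n =
  (\sum_(n < N) a n * x ^_ n) * x ^_ j.
Proof.
move=> a0; elim: j => [|j IHj] mN; first by rewrite muln1.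
rewrite (sum_clique_unionS _ a0 mN) ffactnSr mulnA -IHj; last by lia.
rewrite big_distrl; apply: eq_bigr => n _ /=.
(* The truncated differences [x - n] and [n - j] add up to [x - j] if [j <= n <= x]; otherwise both
   sides are zero. *)
have [nj | jn] := ltnP n j; first by rewrite clique_union_small.
have [xn | nx] := ltnP x n.
  by rewrite !ffact_small ?muln0 // ltnW.
rewrite -mulnA ffactnSr; congr (_ * _).
rewrite mulnC -mulnDl mulnC; congr (_ * _); lia.
Qed.

(** * Moments and the growth of the mean *)

Definition moment (N p : nat) (f : nat -> nat) : nat := \sum_(n < N) n ^ p * f n.

(** With [m p] the moments, [m 0 * (m 0 * m 2 - m 1 ^ 2)] is the sum of the nonnegative
    [f n * (n * m 0 - m 1) ^ 2]. *)
Lemma moment_Cauchy_Schwarz (N : nat) (f : nat -> nat) :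
  moment N 1 f ^ 2 <= moment N 0 f * moment N 2 f.
Proof.
have [f0 | f_gt0] := posnP (moment N 0 f).
  have {}f0 (n : 'I_N) : f n = 0.
    move/eqP: f0; rewrite sum_nat_eq0 => /forallP/(_ n).
    by rewrite mul1n => /eqP.
  by rewrite [moment N 1 f]big1 // => n _; rewrite f0 muln0.
pose m p : int := (moment N p f)%:R%R.
suff : (m 0 * (m 0 * m 2 - m 1 ^+ 2) >= 0)%R.
  rewrite pmulr_rge0 ?ltr0n // subr_ge0 /m -natrX -natrM ler_nat.
  by [].
have sum_quad (u v w : int) : (\sum_(n < N) (f n)%:R * (u * n%:R ^+ 2 + v * n%:R + w) =
    u * m 2 + v * m 1 + w * m 0)%R.
  rewrite /m /moment !natr_sum !mulr_sumr -!big_split /=.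
  by apply: eq_bigr => n _; rewrite !natrM; ring.
have -> : (m 0 * (m 0 * m 2 - m 1 ^+ 2) =
    \sum_(n < N) (f n)%:R * (n%:R * m 0 - m 1) ^+ 2)%R.
  transitivity (m 0 ^+ 2 * m 2 + - (2 * m 0 * m 1) * m 1 + m 1 ^+ 2 * m 0)%R.
    by ring.
  by rewrite -sum_quad; apply: eq_bigr => n _; ring.
by apply: sumr_ge0 => n _; rewrite mulr_ge0 ?ler0n ?sqr_ge0.
Qed.

Section CliqueMoments.

Variables (a : nat -> nat) (m N : nat).
Hypothesis a_supp : forall i, m <= i -> a i = 0.

Let mom p j := moment N p (clique_union a j).

Lemma moment_clique_unionS p j : m + j.+1 <= N ->
  moment N p (clique_union a j.+1) =
  \sum_(n < N) clique_union a j n * (n.+1 ^ p + (n - j) * n ^ p).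
Proof.
move=> mN; rewrite -(sum_clique_unionS (fun n => n ^ p) a_supp mN).
by apply: eq_bigr => n _; rewrite mulnC.
Qed.

(** The weight is [1 + (n - j)]; the term in [j] stands on the left to avoid truncated
    subtraction. *)
Lemma moment0_cliqueS j : m + j.+1 <= N ->
  mom 0 j.+1 + j * mom 0 j = mom 0 j + mom 1 j.
Proof.
move=> mN; rewrite /mom moment_clique_unionS //.
rewrite /moment !big_distrr -!big_split /=.
apply: eq_bigr => n _.
have [nj | jn] := ltnP n j; first by rewrite clique_union_small ?muln0.
move: (clique_union _ _ _) (n - j) (subnK jn) => c d <-.
by rewrite !expn0 expn1; ring.
Qed.

Lemma moment1_cliqueS j : m + j.+1 <= N ->
  mom 1 j.+1 + j * mom 1 j = mom 0 j + mom 1 j + mom 2 j.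
Proof.
move=> mN; rewrite /mom moment_clique_unionS //.
rewrite /moment !big_distrr -!big_split /=.
apply: eq_bigr => n _.
have [nj | jn] := ltnP n j; first by rewrite clique_union_small ?muln0.
move: (clique_union _ _ _) (n - j) (subnK jn) => c d <-.
by rewrite !expn1 expn0; ring.
Qed.

Hypothesis a_gt0 : 0 < mom 0 0.

Lemma moment0_clique_gt0 j : m + j <= N -> 0 < mom 0 j.
Proof.
elim: j => // j IHj mN; apply: leq_trans (IHj _) _; first by lia.
rewrite /mom moment_clique_unionS //; apply: leq_sum => n _.
by rewrite !expn0 mul1n leq_pmulr.
Qed.

(* Adding a clique vertex raises the mean number of colors: the cross
   difference is [moment 0 ^ 2] plus the (unnormalized) variance. *)
Lemma mean_cliqueS j : m + j.+1 <= N ->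
  mom 1 j * mom 0 j.+1 < mom 1 j.+1 * mom 0 j.
Proof.
move=> mN; have CS := moment_Cauchy_Schwarz N (clique_union a j).
have b_gt0 : 0 < mom 0 j by apply: moment0_clique_gt0; lia.
have := moment0_cliqueS mN; have := moment1_cliqueS mN.
move: CS b_gt0; rewrite -!/(mom _ _) -mulnn.
move: (mom 0 j.+1) (mom 1 j.+1) (mom 0 j) (mom 1 j) (mom 2 j) => b' t' b t s.
(* These multipliers give both recurrences the same term [j * t * b], which cancels in the cross
   difference. *)
move=> CS b_gt0 /(congr1 (muln^~ b)) e1 /(congr1 (muln t)) e0.
have : 0 < b * b by rewrite muln_gt0 b_gt0.
nia.
Qed.

Lemma mean_clique_lt i j : i < j -> m + j <= N ->
  mom 1 i * mom 0 j < mom 1 j * mom 0 i.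
Proof.
elim: j => // j IHj; rewrite ltnS leq_eqVlt => /predU1P[-> | ij] mN.
  exact: mean_cliqueS.
have mN' : m + j <= N by lia.
have lt_j := mean_cliqueS mN.
have b_gt0 := moment0_clique_gt0 mN'.
have b'_gt0 := moment0_clique_gt0 mN.
have c_gt0 : 0 < mom 0 i by apply: moment0_clique_gt0; lia.
have {}IHj := IHj ij mN'.
(* Multiplying by the middle denominator [mom 0 j] lets the two cross-multiplied inequalities
   chain. *)
rewrite -(ltn_pmul2r b_gt0) mulnAC.
apply: (@ltn_trans (mom 1 j * mom 0 i * mom 0 j.+1)).
  by rewrite ltn_pmul2r.
by rewrite mulnAC [ltnRHS]mulnAC ltn_pmul2r.
Qed.

End CliqueMoments.

(** * Weighted means under the likelihood ratio order *)

(** By the Binet-Cauchy identity, twice the cross difference is the sum of [F k l] over all ordered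
    pairs. Symmetry of [F] reduces its sign to [l < k], and [(k0, l0)] gives a positive term. *)
Lemma ratio_order_sum (J : nat) (f g b t : nat -> nat) :
  (forall l k, l < k < J -> g k * f l <= f k * g l) ->
  (exists l k, l < k < J /\ g k * f l < f k * g l) ->
  (forall l k, l < k < J -> t l * b k < t k * b l) ->
  (\sum_(k < J) g k * t k) * (\sum_(k < J) f k * b k) <
  (\sum_(k < J) f k * t k) * (\sum_(k < J) g k * b k).
Proof.
move=> fg [l0 [k0 [lk0 lt_fg]]] tb.
pose F (k l : 'I_J) : int :=
  (((f k)%:R * (g l)%:R - (f l)%:R * (g k)%:R) *
   ((t k)%:R * (b l)%:R - (t l)%:R * (b k)%:R))%R.
have F_sym k l : F k l = F l k by rewrite /F; ring.
have F_ge0' (k l : 'I_J) : l < k -> (0 <= F k l)%R.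
  move=> lk; have lkJ : l < k < J by rewrite lk ltn_ord.
  rewrite /F -!natrM mulr_ge0 // subr_ge0 ler_nat; first by rewrite [leqLHS]mulnC fg.
  exact/ltnW/tb.
have F_ge0 k l : (0 <= F k l)%R.
  case: (ltngtP k l) => [kl | lk | /val_inj ->]; last by rewrite /F subrr mul0r.
    by rewrite F_sym F_ge0'.
  exact: F_ge0'.
rewrite -(ltr_nat int) -subr_gt0 -(pmulr_rgt0 _ (ltr0n int 2)) !natrM !natr_sum.
suff -> : (2 * ((\sum_(k < J) (f k * t k)%:R) * (\sum_(k < J) (g k * b k)%:R) -
    (\sum_(k < J) (g k * t k)%:R) * (\sum_(k < J) (f k * b k)%:R)) =
    \sum_(k < J) \sum_(l < J) F k l :> int)%R.
  have [/andP[lk0' k0J]] := (lk0, lk0).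
  have l0J := ltn_trans lk0' k0J.
  rewrite (bigD1 (Ordinal k0J)) //= (bigD1 (Ordinal l0J)) //=.
  rewrite -addrA ltr_pwDl //.
    rewrite /F /= -!natrM mulr_gt0 // subr_gt0 ltr_nat; first by rewrite [ltnLHS]mulnC.
    exact: tb.
  by rewrite addr_ge0 ?sumr_ge0 // => k _; rewrite sumr_ge0.
have dist (u v : 'I_J -> int) :
    ((\sum_k u k) * (\sum_l v l) = \sum_k \sum_l u k * v l)%R.
  by rewrite mulr_suml; apply: eq_bigr => k _; rewrite mulr_sumr.
rewrite mulr2n mulrDl mul1r {1}[X in (X - _)%R]mulrC {1}[X in (_ - X)%R]mulrC !dist.
rewrite -!sumrB -big_split /=; apply: eq_bigr => k _.
rewrite -!sumrB -big_split /=; apply: eq_bigr => l _.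
by rewrite /F !natrM; ring.
Qed.

(** * Disjoint unions and comparison of the averages *)

Lemma num_colorings0 (G : graph) : 0 < #|G| -> num_colorings G 0 = 0.
Proof.
case/card_gt0P=> v _; apply/eqP; rewrite cards_eq0; apply/eqP/setP=> P.
by rewrite inE; apply/imsetP=> -[c]; case: (c v).
Qed.

(** Both sides are the falling factorial coefficients of the same product of chromatic
    polynomials. *)
Lemma num_colorings_disjoint_union (G H : graph) (J N n : nat) :
  #|H| < J -> #|G| + J < N -> n < N ->
  num_colorings (disjoint_union G H) n =
  \sum_(j < J) num_colorings H j * clique_union (num_colorings G) j n.
Proof.
move=> HJ GJ; apply: (@ffact_coef_inj N _ (fun n => \sum_(j < J) _)) => x.
rewrite -chromatic_ffact; last by rewrite card_sum; lia.
rewrite chromatic_disjoint_union (chromatic_ffact _ (N := N)); last by lia.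
rewrite [chromatic H x](chromatic_ffact _ HJ) big_distrr /=.
under [RHS]eq_bigr do rewrite big_distrl /=.
rewrite exchange_big; apply: eq_bigr => j _ /=.
under [RHS]eq_bigr do rewrite -mulnA.
rewrite -big_distrr /= (sum_clique_union_ffact _ (@num_colorings_gt_order G)).
  by rewrite mulnCA.
by have := ltn_ord j; lia.
Qed.

(** Giving each vertex its own color is always proper; index 0 accounts for the empty graph. *)
Lemma moment_num_colorings_gt0 (G : graph) (N : nat) :
  #|G| < N -> 0 < moment N 0 (num_colorings G).
Proof.
move=> GN; have [d [d_classes d_surj]] := surjective_recoloring [ffun v : G => v].
have kN : #|[ffun v : G => v] @: [set: G]| < N.
  by apply: leq_ltn_trans GN; rewrite -cardsT leq_imset_card.
rewrite /moment (bigD1 (Ordinal kN)) //= mul1n ltn_addr //.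
apply/card_gt0P; exists (color_classes d); apply/imsetP; exists d => //.
rewrite inE d_surj eqxx andbT (eq_classes_proper d_classes).
apply/'forall_'forall_implyP => v w vw; rewrite !ffunE.
by apply: contraTneq vw => ->; rewrite adj_irrefl.
Qed.

Lemma sum_colorings_moment (G H : graph) (J N p : nat) :
  0 < #|H| -> #|H| < J -> #|G| + J < N ->
  \sum_(1 <= k < #|disjoint_union G H|.+1)
    k ^ p * num_colorings (disjoint_union G H) k =
  \sum_(j < J) num_colorings H j * moment N p (clique_union (num_colorings G) j).
Proof.
move=> H_gt0 HJ GJ; have cardU : #|disjoint_union G H| = #|G| + #|H| := card_sum _ _.
transitivity (moment N p (num_colorings (disjoint_union G H))).
  rewrite /moment -(big_mkord xpredT (fun k => k ^ p * _ k)).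
  have UN : #|disjoint_union G H|.+1 <= N by lia.
  rewrite [RHS](big_cat_nat _ UN) //= [X in _ = _ + X]big_nat_cond.
  rewrite [X in _ = _ + X]big1 ?addn0 => [|k /andP[/andP[Uk _] _]]; last first.
    by rewrite num_colorings_gt_order ?muln0.
  (* The left sum starts at 1. When [p = 0] the factor [0 ^ 0] is 1, so the extra term vanishes only
     because the union has a vertex. *)
  by rewrite [RHS]big_ltn // num_colorings0 ?muln0 //; lia.
rewrite /moment; under eq_bigr => n _.
  rewrite (num_colorings_disjoint_union HJ GJ) // big_distrr /=; over.
rewrite exchange_big; apply: eq_bigr => j _ /=.
by rewrite big_distrr; apply: eq_bigr => n _; rewrite mulnCA.
Qed.

Theorem theorem9 (H1 H2 : graph)
  (hle : forall k k' : nat, 0 < k' -> k' < k ->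
     num_colorings H1 k * num_colorings H2 k' >=
     num_colorings H2 k * num_colorings H1 k')
  (hlt : exists k k' : nat, [/\ 0 < k', k' < k &
     num_colorings H1 k * num_colorings H2 k' >
     num_colorings H2 k * num_colorings H1 k'])
  (G : graph) :
  (avg_colors (disjoint_union G H1) > avg_colors (disjoint_union G H2))%R.
Proof.
have order_ge H k : 0 < num_colorings H k -> k <= #|H|.
  by move=> S_gt0; rewrite leqNgt; apply: contraL S_gt0 => /num_colorings_gt_order->.
have [k [l [l_gt0 lk S_lt]]] := hlt.
(* The strict pair makes these counts positive, which forces both graphs to have vertices and bounds
   [k] and [l] by their orders. *)
have /andP[S1_gt0 S2_gt0] : (0 < num_colorings H1 k) && (0 < num_colorings H2 l).
  by rewrite -muln_gt0; apply: leq_ltn_trans S_lt.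
have kH1 := order_ge _ _ S1_gt0; have lH2 := order_ge _ _ S2_gt0.
have H1_gt0 : 0 < #|H1| by lia.
have H2_gt0 : 0 < #|H2| by lia.
pose J := (#|H1| + #|H2|).+1; pose N := (#|G| + J).+1.
have H1J : #|H1| < J by rewrite ltnS leq_addr.
have H2J : #|H2| < J by rewrite ltnS leq_addl.
have G_small := @num_colorings_gt_order G.
have G_gt0 : 0 < moment N 0 (num_colorings G).
  by apply: moment_num_colorings_gt0; lia.
pose mom p j := moment N p (clique_union (num_colorings G) j).
have mom0_gt0 j : j < J -> 0 < mom 0 j.
  by move=> jJ; apply: (moment0_clique_gt0 G_small) => //; lia.
have total_coloringsE (H : graph) : 0 < #|H| -> #|H| < J ->
    total_colorings (disjoint_union G H) = \sum_(j < J) num_colorings H j * mom 0 j.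
  move=> H_gt0 HJ; rewrite -sum_colorings_moment //.
  by apply: eq_bigr => i _; rewrite mul1n.
have total_colorsE (H : graph) : 0 < #|H| -> #|H| < J ->
    total_colors (disjoint_union G H) = \sum_(j < J) num_colorings H j * mom 1 j.
  by move=> H_gt0 HJ; rewrite -sum_colorings_moment.
have total_gt0 H j : 0 < num_colorings H j -> j < J ->
    0 < \sum_(j < J) num_colorings H j * mom 0 j.
  move=> S_gt0 jJ; rewrite (bigD1 (Ordinal jJ)) //= ltn_addr //.
  by rewrite muln_gt0 S_gt0 mom0_gt0.
have kJ : k < J by lia.
have lJ : l < J by lia.
rewrite /avg_colors !total_coloringsE // !total_colorsE //.
rewrite ltr_pdivrMr ?ltr0n ?(total_gt0 _ l) //.
rewrite mulrAC ltr_pdivlMr ?ltr0n ?(total_gt0 _ k) //.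
rewrite -!natrM ltr_nat; apply: ratio_order_sum.
(* The hypothesis concerns positive indices; at index 0 both products vanish since the graphs have
   vertices. *)
- move=> [|i] j /andP[ij jJ]; last exact: hle.
  by rewrite !num_colorings0 ?muln0.
- by exists l, k; rewrite lk kJ.
- move=> i j /andP[ij jJ].
  by apply: (mean_clique_lt G_small) => //; lia.
Qed.
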